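(* Let $(X,d,\bar x)$ be a pointed metric space and let $M\subseteq X$ be a closed subspace with $\bar x\in M$ having the following finite extension Lipschitz property: there is a constant $C$ such that for every finite $F\subseteq M$ with $\bar x\in F$ there exists a linear extension operator $$E_F:\mathrm{Lip}_0(F)\to\mathrm{Lip}_0(X)$$ with $\|E_F\|\le C$ (with $C$ independent of $F$). Then there exists a linear extension operator $$E:\mathrm{Lip}_0(M)\to\mathrm{Lip}_0(X)$$ with $\|E\|\le C$.
   Context: For a pointed metric space $(Y,d,\bar x)$, $\mathrm{Lip}_0(Y)$ is the Banach space of real-valued Lipschitz functions on $Y$ vanishing at $\bar x$, normed by the Lipschitz constant; it is used for $Y=X,M,F$ with the same base point $\bar x$. For $S\subseteq X$ with $\bar x\in S$, an extension operator $E:\mathrm{Lip}_0(S)\to\mathrm{Lip}_0(X)$ is an operator with $E(f)|_S=f$ for all $f\in\mathrm{Lip}_0(S)$. *)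

(* Defs.v *)
From HB Require Import structures.
From mathcomp Require Import all_boot all_order all_algebra.
From mathcomp Require Import all_classical all_reals all_analysis.

Set Implicit Arguments.
Unset Strict Implicit.
Unset Printing Implicit Defensive.

Import Order.TTheory GRing.Theory Num.Theory.
Import numFieldNormedType.Exports.

Local Open Scope classical_set_scope.
Local Open Scope ring_scope.

(* [set_type A] already carries the induced pseudometric; its balls are the
   traces of the balls of X, so the distance below is the restricted one. *)
Section subspace_metric.
Context {R : realType} {X : metricType R} (A : set X).

Let sub_dist (x y : A) : R := mdist (set_val x) (set_val y).

Let sub_dist_ge0 x y : 0 <= sub_dist x y.
Proof. exact: mdist_ge0. Qed.

Let sub_dist_positivity x y : sub_dist x y = 0 -> x = y.
Proof. by move=> /mdist_positivity /val_inj. Qed.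

Let ballE_sub_dist (x : A) (d : R) : ball x d = [set y | sub_dist x y < d].
Proof. by rewrite -initial_ballE ballEmdist. Qed.

HB.instance Definition _ := @PseudoMetric_isMetric.Build R (set_type A)
  sub_dist sub_dist_ge0 sub_dist_positivity ballE_sub_dist.

End subspace_metric.

Section lip0_def.
Context {R : realType} {X : metricType R}.

Definition klip (k : R) (f : X -> R^o) : Prop :=
  forall x y, `|f x - f y| <= k * mdist x y.

Definition lip0_pred (x0 : X) : {pred X -> R^o} :=
  [pred f | `[< (exists k, klip k f) /\ f x0 = 0 >]].

Record lip0 (x0 : X) := Lip0 {
  lip0_fun :> X -> R^o ;
  lip0_funP : lip0_fun \in lip0_pred x0 }.

End lip0_def.

Section lip0_lmodule.
Context {R : realType} {X : metricType R} (x0 : X).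

Let lip0_submod : submod_closed (lip0_pred x0).
Proof.
split => [|a f g].
  apply/asboolP; split=> //; exists 0 => x y /=.
  by rewrite subrr normr0 mul0r.
move=> /asboolP[[k kf] f0] /asboolP[[l lg] g0]; apply/asboolP; split; last first.
  by rewrite !fctE /= g0 addr0 f0 scaler0.
exists (`|a| * k + l) => x y; rewrite mulrDl -mulrA.
have -> : (a *: f + g) x - (a *: f + g) y = a * (f x - f y) + (g x - g y).
  by rewrite !fctE /GRing.scale /= opprD addrACA mulrBr.
by rewrite (le_trans (ler_normD _ _))// lerD// normrM ler_wpM2l.
Qed.

HB.instance Definition _ := [isSub for @lip0_fun R X x0].
HB.instance Definition _ := [Choice of lip0 x0 by <:].
HB.instance Definition _ :=
  GRing.isSubmodClosed.Build R (X -> R^o) (lip0_pred x0) lip0_submod.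
HB.instance Definition _ := [SubChoice_isSubLmodule of lip0 x0 by <:].

End lip0_lmodule.

Section lip0_normed.
Context {R : realType} {X : metricType R} (x0 : X).
Implicit Types f g : lip0 x0.

(* [sup set0 = 0], so the norm is 0 on a one-point space. *)
Definition lip_const (f : X -> R^o) : R :=
  sup [set `|f p.1 - f p.2| / mdist p.1 p.2 | p in [set p : X * X | p.1 != p.2]].

Lemma lip0_base f : f x0 = 0.
Proof. by have /asboolP[] := lip0_funP f. Qed.

Lemma lip0P f g : (forall x, f x = g x) -> f = g.
Proof. by move=> fg; apply/val_inj/funext. Qed.

Let klip_ub k f p : klip k f -> p.1 != p.2 ->
  `|f p.1 - f p.2| / mdist p.1 p.2 <= k.
Proof. by move=> kf p12; rewrite ler_pdivrMr ?mdist_gt0. Qed.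

Lemma klip_lip_const f : klip (lip_const f) f.
Proof.
move=> x y; have [->|xy] := eqVneq x y.
  by rewrite subrr normr0 mdistxx mulr0.
rewrite -ler_pdivrMr ?mdist_gt0//; apply: ub_le_sup; last by exists (x, y).
have /asboolP[[k kf] _] := lip0_funP f.
by exists k => _ [p p12 <-]; exact: klip_ub.
Qed.

Lemma lip_const_ge0 f : 0 <= lip_const f.
Proof.
have [/set0P[_ [p p12 _]]|/negPn/eqP A0] := boolP ([set `|f p.1 - f p.2| /
    mdist p.1 p.2 | p in [set p : X * X | p.1 != p.2]] != set0).
  rewrite -(@pmulr_lge0 _ (mdist p.1 p.2)) ?mdist_gt0//.
  exact: le_trans (klip_lip_const f _ _).
by rewrite /lip_const A0 sup0.
Qed.

Lemma lip_const_le f k : 0 <= k -> klip k f -> lip_const f <= k.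
Proof.
move=> k0 kf; rewrite /lip_const; set A := [set _ | _ in _].
have [->|/set0P A0] := eqVneq A set0; first by rewrite sup0.
by apply: ge_sup => // _ [p p12 <-]; exact: klip_ub.
Qed.

Let lip_constD f g : lip_const (f + g) <= lip_const f + lip_const g.
Proof.
apply: lip_const_le => [|x y]; first by rewrite addr_ge0 ?lip_const_ge0.
rewrite mulrDl /= opprD addrACA (le_trans (ler_normD _ _))//.
by rewrite lerD// klip_lip_const.
Qed.

Let lip_constZ_le (a : R) f : lip_const (a *: f) <= `|a| * lip_const f.
Proof.
apply: lip_const_le => [|x y]; first by rewrite mulr_ge0 ?lip_const_ge0.
rewrite -mulrA.
have -> : (a *: f) x - (a *: f) y = a * (f x - f y) by rewrite mulrBr.
by rewrite normrM ler_wpM2l// klip_lip_const.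
Qed.

Let lip_constZ (a : R) f : lip_const (a *: f) = `|a| * lip_const f.
Proof.
apply/eqP; rewrite eq_le lip_constZ_le andTb.
have [->|a0] := eqVneq a 0; first by rewrite normr0 mul0r lip_const_ge0.
rewrite mulrC -ler_pdivlMr ?normr_gt0// mulrC -normfV.
by have := lip_constZ_le a^-1 (a *: f); rewrite scalerA mulVf// scale1r.
Qed.

Let lip_const0_eq0 f : lip_const f = 0 -> f = 0.
Proof.
move=> f0; apply: lip0P => x; have := klip_lip_const f x x0.
by rewrite f0 mul0r lip0_base subr0 normr_le0 => /eqP.
Qed.

HB.instance Definition _ := @Lmodule_isNormed.Build R (lip0 x0)
  (fun f => lip_const f) lip_constD lip_constZ lip_const0_eq0.

Lemma lip0_normE f : `|f| = lip_const f. Proof. by []. Qed.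

End lip0_normed.

(* Valued in [\bar R]: it is [+oo] when E is unbounded. *)
Definition op_norm {R : realType} {V W : normedModType R}
    (E : {linear V -> W}) : \bar R :=
  ereal_sup [set `|E v|%:E | v in [set v : V | `|v| <= 1]].

Section extension.
Context {R : realType} {X : metricType R} (x0 : X).

Definition sub_base {S : set X} (Sx0 : S x0) : S := SigSub (mem_set Sx0).

Definition extension_operator {S : set X} (Sx0 : S x0)
    (E : lip0 (sub_base Sx0) -> lip0 x0) : Prop :=
  forall (f : lip0 (sub_base Sx0)) (s : S), E f (set_val s) = f s.

End extension.

(* Main.v *)
(* For each finite F in M the map f |-> E_F (f|_F) is linear, has norm at most
   C, and reproduces f on F. For fixed f and x the values E_F (f|_F) x stay in
   a bounded interval, so they converge along an ultrafilter refining the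
   directed family of finite subsets of M. The pointwise limit is linear in f,
   keeps the Lipschitz bound, and extends f since every point of M eventually
   lies in F. *)
From HB Require Import structures.
Require Import Defs.
From mathcomp Require Import all_boot all_order all_algebra.
From mathcomp Require Import all_classical all_reals all_analysis.
Import Order.TTheory GRing.Theory Num.Theory.
Import numFieldNormedType.Exports.

Local Open Scope classical_set_scope.
Local Open Scope ring_scope.

Lemma ultra_fmap {T U : Type} (f : T -> U) (F : set_system T) :
  UltraFilter F -> UltraFilter (f @ F).
Proof.
move=> FU; split; first exact: fmap_proper_filter.
move=> G GP FG; apply/seteqP; split => [A GA|]; last exact: FG.
have [//|FnA] := in_ultra_setVsetC (f @^-1` A) FU.
have /filter_ex[y []//] : G (A `&` ~` A) by apply: filterI => //; exact: FG.
Qed.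

(** Compactness of [[-k, k]] in its ultrafilter form, applied to the image ultrafilter. *)
Lemma ultra_bounded_is_cvg {R : realType} {T : Type} {F : set_system T}
    (g : T -> R) (k : R) :
  UltraFilter F -> (forall t, `|g t| <= k) -> cvg (g @ F).
Proof.
move=> FU gk; have := @segment_compact R (- k) k.
rewrite compact_ultra => /(_ _ (ultra_fmap g F FU))[|l [_ gl]].
  by apply: (@filterE _ F) => t /=; rewrite in_itv/= -ler_norml.
by apply/cvg_ex; exists l.
Qed.

Section op_norm_theory.
Context {R : realType} {V W : normedModType R}.
Implicit Type E : {linear V -> W}.

Lemma op_norm_ge0 E : (0 <= op_norm E)%E.
Proof.
by apply: ereal_sup_ubound; exists 0; rewrite /= ?linear0 normr0.
Qed.

Lemma op_norm_bound E (C : R) : (op_norm E <= C%:E)%E ->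
  forall v, `|E v| <= C * `|v|.
Proof.
move=> EC v; have [->|v0] := eqVneq v 0.
  by rewrite linear0 !normr0 mulr0.
rewrite -ler_pdivrMr ?normr_gt0// mulrC.
(* Rescaling [v] to norm 1 makes it compete in the supremum. *)
have : (`|E (`|v|^-1 *: v)|%:E <= C%:E)%E.
  apply: le_trans EC; apply: ereal_sup_ubound; exists (`|v|^-1 *: v) => //=.
  by rewrite normrZ normfV normr_id mulVf// normr_eq0.
by rewrite lee_fin linearZ/= normrZ normfV normr_id.
Qed.

Lemma op_norm_le E (C : R) : 0 <= C -> (forall v, `|E v| <= C * `|v|) ->
  (op_norm E <= C%:E)%E.
Proof.
move=> C0 EC; apply: ge_ereal_sup => _ [v /= v1 <-].
by rewrite lee_fin (le_trans (EC v))// ler_piMr.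
Qed.

End op_norm_theory.

Section restriction.
Context {R : realType} {X : metricType R} {x0 : X} {M F : set X}.
Context (Mx0 : M x0) (Fx0 : F x0) (FM : F `<=` M).

Let incl (s : F) : M := SigSub (mem_set (FM (set_val s) (set_valP s))).

Let restr_subproof (f : lip0 (sub_base Mx0)) :
  f \o incl \in lip0_pred (sub_base Fx0).
Proof.
apply/asboolP; split; last first.
  by rewrite /= -[RHS](lip0_base f); congr (f _); apply: val_inj.
by exists (lip_const f) => x y; exact: klip_lip_const.
Qed.

Definition restr f : lip0 (sub_base Fx0) := Lip0 (restr_subproof f).

(** The two points may carry different membership proofs, which proof irrelevance identifies. *)
Lemma restrE f (s : M) (t : F) : set_val t = set_val s -> restr f t = f s.
Proof. by move=> ts; congr (f _); apply: val_inj. Qed.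

Lemma restr_linear : linear restr.
Proof. by move=> a f g; apply: lip0P. Qed.

Lemma norm_restr f : `|restr f| <= `|f|.
Proof.
apply: lip_const_le => [|x y]; first exact: normr_ge0.
exact: (klip_lip_const f (incl x) (incl y)).
Qed.

End restriction.

Theorem corollary2p17 (R : realType) (X : metricType R) (x0 : X) (M : set X)
    (M_closed : closed M) (Mx0 : M x0) (C : R)
    (finite_extension : forall F : set X, finite_set F -> F `<=` M ->
      forall Fx0 : F x0,
      exists E_F : {linear lip0 (sub_base Fx0) -> lip0 x0},
        extension_operator E_F /\ (op_norm E_F <= C%:E)%E) :
  exists E : {linear lip0 (sub_base Mx0) -> lip0 x0},
    extension_operator E /\ (op_norm E <= C%:E)%E.
Proof.
pose adm (F : set X) := [/\ finite_set F, F `<=` M & F x0].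
have adm1 : adm [set x0] by split=> // _ ->.
(* The set [[set x0]] is admissible, so [C] bounds the norm of some operator. *)
have C0 : 0 <= C.
  have [F1 FM Fx0] := adm1; have [E [_ EC]] := finite_extension _ F1 FM Fx0.
  by rewrite -lee_fin (le_trans _ EC)// op_norm_ge0.
(* To choose over all sets at once, [e F] is set to 0 when [F] is not admissible. Linearity, the
   Lipschitz bound and the value at [x0] then hold for every [F]; only the extension property needs
   [adm F]. *)
have /choice[e eP] : forall F : set X, exists e : lip0 (sub_base Mx0) -> X -> R,
    [/\ forall a f g x, e (a *: f + g) x = a * e f x + e g x,
        forall f, klip (C * `|f|) (e f),
        forall f, e f x0 = 0
      & adm F -> forall f (s : M), F (set_val s) -> e f (set_val s) = f s].
  move=> F; have [[F1 FM Fx0]|nF] := pselect (adm F); last first.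
    exists (fun _ _ => 0); split=> // [a _ _ _|f x y].
      by rewrite mulr0 addr0.
    by rewrite subrr normr0 !mulr_ge0// mdist_ge0.
  have [E [Eext EC]] := finite_extension _ F1 FM Fx0.
  exists (fun f => E (restr Mx0 Fx0 FM f) : lip0 x0).
  split=> [a f g x|f x y|f|_ f s Fs].
  - by rewrite restr_linear linearP.
  - apply: le_trans (klip_lip_const _ _ _) _.
    rewrite ler_wpM2r ?mdist_ge0// -lip0_normE.
    by rewrite (le_trans (op_norm_bound _ _ EC _))// ler_wpM2l// norm_restr.
  - exact: lip0_base.
  - by rewrite (Eext _ (SigSub (mem_set Fs))); apply: restrE.
(* The filter of tails of the admissible sets ordered by inclusion, directed because unions of two
   are admissible. *)
pose B := filter_from adm (fun F => [set G | adm G /\ F `<=` G]).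
have BP : ProperFilter B.
  apply: filter_from_proper => [|F aF]; last by exists F; split.
  apply: filter_from_filter => [|F G [F1 FM Fx0] [G1 GM Gx0]].
    by exists [set x0].
  exists (F `|` G) => [|H [aH]]; last by rewrite subUset => -[FH GH].
  by split; [rewrite finite_setU|rewrite subUset|left].
have [U [UU BU]] := ultraFilterLemma BP.
pose L f x := lim (e F f x @[F --> U]).
have Lcvg f x : e F f x @[F --> U] --> L f x.
  (* Comparing with the value 0 at [x0] gives a bound independent of [F]. *)
  apply: (ultra_bounded_is_cvg _ (C * `|f| * mdist x x0)) => F.
  by have [_ /(_ f x x0) + ef0 _] := eP F; rewrite ef0 subr0.
have Llip f : klip (C * `|f|) (L f).
  move=> x y; rewrite -(cvg_lim _ (cvg_norm (cvgB (Lcvg f x) (Lcvg f y))))//.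
  apply: limr_le; last by apply: nearW => F; have [_ ef _ _] := eP F; exact: ef.
  by apply/cvg_ex; eexists; exact: cvg_norm (cvgB (Lcvg f x) (Lcvg f y)).
have L0 f : L f x0 = 0.
  apply: cvg_lim => //; apply: cvg_near_cst; apply: nearW => F.
  by have [_ _ ->] := eP F.
have Lmem f : (L f : X -> R^o) \in lip0_pred x0.
  by apply/asboolP; split => //; exists (C * `|f|).
pose E f := Lip0 (Lmem f).
have E_linear : linear E.
  move=> a f g; apply: lip0P => x; apply: cvg_lim => //.
  have -> : (fun F => e F (a *: f + g) x) = fun F => a * e F f x + e F g x.
    by apply/funext => F; have [-> _ _ _] := eP F.
  exact: cvgD (cvgM (cvg_cst a) (Lcvg f x)) (Lcvg g x).
pose E_isLinear := GRing.isLinear.Build R _ _ *:%R E E_linear.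
pose El : {linear lip0 (sub_base Mx0) -> lip0 x0} := HB.pack E E_isLinear.
exists El; split => [f s|].
  apply: cvg_lim => //; apply: cvg_near_cst; apply: BU.
  (* Every admissible set containing this one contains [s], so along this tail the value at [s] is
     constantly [f s]. *)
  exists ([set x0] `|` [set set_val s]) => [|F [aF sF]].
    split; [by rewrite finite_setU|rewrite subUset|by left].
    by split=> _ ->; [|exact: set_valP].
  by have [_ _ _ ->//] := eP F; apply: sF; right.
apply: op_norm_le => // f.
exact: (@lip_const_le _ _ _ (E f) _ (mulr_ge0 C0 (normr_ge0 f)) (Llip f)).
Qed.
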